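(* Let $G$ be a maximal $3$-$\gamma_{c}$-vertex critical graph, with independence number $\alpha$ and minimum degree $\delta$. Then $\alpha \leq \delta$.
   Context: All graphs are finite, simple and connected. A set $D\subseteq V(G)$ is a connected dominating set of $G$ if every vertex of $G$ is in $D$ or adjacent to a vertex of $D$, and $G[D]$ is connected. The connected domination number $\gamma_{c}(G)$ is the minimum cardinality of a connected dominating set. A graph $G$ is $k$-$\gamma_{c}$-edge critical if $\gamma_{c}(G)=k$ and $\gamma_{c}(G+uv)<k$ for every pair of non-adjacent vertices $u,v$. A $2$-connected graph $G$ is $k$-$\gamma_{c}$-vertex critical if $\gamma_{c}(G)=k$ and $\gamma_{c}(G-v)<k$ for every $v\in V(G)$. A graph is maximal $k$-$\gamma_{c}$-vertex critical if it is both $k$-$\gamma_{c}$-edge critical and $k$-$\gamma_{c}$-vertex critical. *)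

(* Defs.v *)
From mathcomp Require Import all_boot.
Set Implicit Arguments. Unset Strict Implicit. Unset Printing Implicit Defensive.

(* A finite simple graph is represented by a vertex set V : {set T} over a
   finType T together with an adjacency relation e : rel T that is symmetric
   and irreflexive; the graph is the subgraph induced by e on V.  This lets us
   delete vertices (V :\ v) and add edges (add_edge e u v) without changing types. *)

Definition connected_in {T : finType} (e : rel T) (S : {set T}) : Prop :=
  forall x y, x \in S -> y \in S -> connect (fun a b => [&& a \in S, b \in S & e a b]) x y.

Definition simple_graph {T : finType} (e : rel T) : Prop :=
  symmetric e /\ irreflexive e.

Definition graph_connected {T : finType} (e : rel T) (V : {set T}) : Prop :=
  V != set0 /\ connected_in e V.

Definition cds {T : finType} (e : rel T) (V D : {set T}) : bool :=
  [&& D \subset V,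
      [forall x in V, (x \in D) || [exists y in D, e x y]] &
      [forall x in D, forall y in D,
         connect (fun a b => [&& a \in D, b \in D & e a b]) x y]].

Definition gamma_c {T : finType} (e : rel T) (V : {set T}) : nat :=
  \big[minn/#|T|.+1]_(D : {set T} | cds e V D) #|D|.

Definition add_edge {T : finType} (e : rel T) (u v : T) : rel T :=
  fun x y => [|| e x y, (x == u) && (y == v) | (x == v) && (y == u)].

Definition edge_critical {T : finType} (e : rel T) (V : {set T}) (k : nat) : Prop :=
  gamma_c e V = k /\
  forall u v, u \in V -> v \in V -> u != v -> ~~ e u v ->
    gamma_c (add_edge e u v) V < k.

Definition two_connected {T : finType} (e : rel T) (V : {set T}) : Prop :=
  2 < #|V| /\ graph_connected e V /\ forall v, v \in V -> graph_connected e (V :\ v).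

Definition vertex_critical {T : finType} (e : rel T) (V : {set T}) (k : nat) : Prop :=
  two_connected e V /\ gamma_c e V = k /\
  forall v, v \in V -> gamma_c e (V :\ v) < k.

Definition maximal_vertex_critical {T : finType} (e : rel T) (V : {set T}) (k : nat) : Prop :=
  edge_critical e V k /\ vertex_critical e V k.

Definition independent {T : finType} (e : rel T) (V S : {set T}) : bool :=
  (S \subset V) && [forall x in S, forall y in S, ~~ e x y].

Definition alpha {T : finType} (e : rel T) (V : {set T}) : nat :=
  \max_(S : {set T} | independent e V S) #|S|.

Definition degree {T : finType} (e : rel T) (V : {set T}) (v : T) : nat :=
  #|[set u in V | e v u]|.

Definition min_degree {T : finType} (e : rel T) (V : {set T}) : nat :=
  \big[minn/#|T|]_(v in V) degree e V v.

(* Main.v *)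
(** Pass to the complement [h] of the graph. Being maximal 3-critical
    means there:
    every non-adjacent pair has a common neighbour, every vertex [c] is the only
    common neighbour of some non-adjacent pair, and an edge [ab] with a common
    neighbour has [b] as the only common neighbour of [a] and some non-neighbour
    [w] of [a], or the same with [a] and [b] exchanged. The degree of [v] becomes
    the number of its non-neighbours, so a clique [K] must be shown to be no
    larger than the set of non-neighbours of any [v]. Applied to an edge [ab] of
    [K], the edge condition gives a [w] outside [K] whose only neighbour in [K]
    is [b]; this nearly injects [K] into the non-neighbours of [v]. If the bound
    fails, every non-neighbour of [v] outside [K] arises in this way, except
    possibly one when [v] is in [K], and the vertex condition is then violated
    for one of these non-neighbours if [v] is in [K], and otherwise for the
    exceptional vertex [a] of [K], for a [q] adjacent only to [a] in [K], or for
    a vertex of [K] sharing only [a] with [q]. *)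
Require Import Defs.
From mathcomp Require Import all_boot.

Set Implicit Arguments. Unset Strict Implicit. Unset Printing Implicit Defensive.

(** * Vertices and their non-neighbours in the complement graph *)

Section Complement.

Variables (T : finType) (V : {set T}) (h : rel T).

Hypothesis h_sym : symmetric h.
Hypothesis h_irr : irreflexive h.
Hypothesis h_V : forall x y, h x y -> x \in V.

Definition sole_common_nbr (p q c : T) : Prop :=
  [/\ p != q, ~~ h p q, h c p & h c q] /\ forall x, h x p -> h x q -> x = c.

Hypothesis vertex_crit : forall c, c \in V -> exists p q, sole_common_nbr p q c.
Hypothesis edge_crit : forall a b c, h a b -> h c a -> h c b ->
  (exists w, sole_common_nbr a w b) \/ (exists w, sole_common_nbr b w a).

Definition non_nbrs (v : T) : {set T} := [set w in V | (w != v) && ~~ h v w].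

Lemma sole_common_nbrC p q c : sole_common_nbr p q c -> sole_common_nbr q p c.
Proof.
case=> [[npq hpq cp cq] u]; split; last by move=> x xq xp; exact: u.
by split=> //; rewrite 1?eq_sym 1?h_sym.
Qed.

(** A [v] adjacent to both [p] and [q] would be [c]. If [v] is one of them, the other is a
    non-neighbour because [p] and [q] are not adjacent. *)
Lemma sole_non_nbr p q c v : sole_common_nbr p q c -> v != c ->
  p \in non_nbrs v \/ q \in non_nbrs v.
Proof.
case=> [[npq hpq cp cq] u] nvc.
have pV : p \in V by apply: (h_V (y := c)); rewrite h_sym.
have qV : q \in V by apply: (h_V (y := c)); rewrite h_sym.
rewrite !inE pV qV /=.
have [pv|npv] := eqVneq p v.
  by right; rewrite -pv hpq eq_sym npq.
have [qv|nqv] := eqVneq q v.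
  by left; rewrite -qv h_sym hpq.
have [hvp|] := boolP (h v p); last by left.
have [hvq|] := boolP (h v q); last by right.
by rewrite (u v) ?eqxx in nvc.
Qed.

Lemma non_nbrs_dominate v c : c \in V -> v != c ->
  exists2 p, p \in non_nbrs v & h c p.
Proof.
move=> cV nvc; have [p [q pqc]] := vertex_crit cV.
have [[_ _ cp cq] _] := pqc.
by have [pW|qW] := sole_non_nbr pqc nvc; [exists p | exists q].
Qed.

(** Settles cliques of at most two vertices. Domination is applied twice, and adjacent vertices are
    distinct. *)
Lemma non_nbrs_gt1 v : 1 < #|V| -> 1 < #|non_nbrs v|.
Proof.
case/card_gt1P=> x [y [xV yV nxy]].
have [c cV nvc] : exists2 c, c \in V & v != c.
  by have [vx|nvx] := eqVneq v x; [exists y; rewrite ?vx | exists x].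
have [p pW _] := non_nbrs_dominate cV nvc.
have := pW; rewrite inE => /and3P[pV npv _].
have [q qW hpq] : exists2 q, q \in non_nbrs v & h p q.
  by apply: non_nbrs_dominate => //; rewrite eq_sym.
apply/card_gt1P; exists p, q; split=> //.
by apply: contraTneq hpq => ->; rewrite h_irr.
Qed.

(** * Cliques compared with the non-neighbours of a vertex *)

Section Clique.

Variables (K : {set T}) (v : T).
Hypothesis K_V : K \subset V.
Hypothesis K_clique : {in K &, forall x y, x != y -> h x y}.
Hypothesis K_gt2 : 2 < #|K|.

Definition private (b w : T) : bool :=
  [&& w \in non_nbrs v, w \notin K & [forall k in K, h k w == (k == b)]].

Lemma privateE b w k : private b w -> k \in K -> h k w = (k == b).
Proof. by case/and3P=> _ _ /forall_inP + kK => /(_ k kK)/eqP. Qed.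

(** A third vertex of [K] is the common neighbour that [edge_crit] asks for. *)
Lemma clique_edge_crit a b : a \in K -> b \in K -> a != b ->
  (exists w, sole_common_nbr a w b) \/ (exists w, sole_common_nbr b w a).
Proof.
move=> aK bK nab.
have /subsetPn[c cK] : ~~ (K \subset [set a; b]).
  by apply: contraTN K_gt2 => /subset_leq_card; rewrite cards2 nab -leqNgt.
rewrite !inE negb_or => /andP[nca ncb].
by apply: (edge_crit (c := c)); exact: K_clique.
Qed.

Lemma sole_notin_clique a b w : a \in K -> sole_common_nbr a w b -> w \notin K.
Proof.
move=> aK [[naw hab _ _] _].
by apply: contra hab => wK; exact: K_clique.
Qed.

(** Since [a] is not adjacent to [w], such a [k] differs from [a], so it is a common neighbour of
    [a] and [w]. *)
Lemma sole_clique_nbr a b w : a \in K -> sole_common_nbr a w b ->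
  {in K, forall k, h k w -> k = b}.
Proof.
move=> aK [[naw hab hba hbw] u] k kK hkw; apply: u => //; apply: K_clique => //.
by apply: contraNneq hab => <-.
Qed.

(** If [v] were adjacent to [w], it would be a second common neighbour of [a] and [w]. *)
Lemma sole_private a b w : a \in K -> h v a -> v != b ->
  sole_common_nbr a w b -> private b w.
Proof.
move=> aK hva nvb s; have [[naw haw hba hbw] u] := s.
apply/and3P; split; last 2 first.
- exact: sole_notin_clique s.
- apply/forall_inP=> k kK; apply/eqP; apply/idP/eqP; last by move=> ->.
  exact: sole_clique_nbr s k kK.
have wV : w \in V by apply: (h_V (y := b)); rewrite h_sym.
rewrite inE wV /=; apply/andP; split.
  by apply: contraNneq haw => ->; rewrite h_sym.
by apply: contra nvb => hvw; apply/eqP; exact: u.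
Qed.

Lemma clique_mem_bound : v \in K -> #|K| <= #|non_nbrs v|.
Proof.
move=> vK; rewrite leqNgt; apply/negP=> ltWK.
pose J := K :\ v; pose W := non_nbrs v.
have WK w : w \in W -> w \notin K.
  rewrite inE => /and3P[_ nwv nvw]; apply: contra nvw => wK.
  by apply: K_clique; rewrite // eq_sym.
(* [f] prefers private neighbours. The default [b] is never taken, since domination always supplies
   a candidate in [W]. *)
have [f fP] : exists f : T -> T, {in J, forall b, [/\ f b \in W, h b (f b)
    & (exists w, private b w) -> private b (f b)]}.
  pose P b w := [&& w \in W, h b w & [exists w', private b w'] ==> private b w].
  exists (fun b => odflt b [pick w | P b w]) => b; rewrite in_setD1 => /andP[nbv bK].
  case: pickP => [w /and3P[? ? /implyP i]|none] /=.
    by split=> // -[w' ?]; apply: i; apply/existsP; exists w'.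
  have [/existsP[w bw]|np] := boolP [exists w', private b w'].
    have /and3P[wW _ _] := bw.
    by have := none w; rewrite /P /= bw wW implybT andbT (privateE bw) ?eqxx.
  have [||p pW hbp] := @non_nbrs_dominate v b; first exact: (subsetP K_V).
    by rewrite eq_sym.
  by have := none p; rewrite /P (negPf np) hbp andbT pW.
have arc_f a b w : a \in J -> b \in J -> sole_common_nbr a w b -> private b (f b).
  move=> /setD1P[nav aK] bJ s.
  have [_ _ ->] // := fP _ bJ.
  exists w; apply: (sole_private aK) s; last by rewrite eq_sym; case/setD1P: bJ.
  by apply: K_clique; rewrite // eq_sym.
have clash a b w : a \in J -> b \in J -> a != b -> sole_common_nbr a w b -> f a != f b.
  move=> aJ bJ nab s; apply: contraNneq nab => eqf.
  have [_ haf _] := fP _ aJ; have pb := arc_f _ _ _ aJ bJ s.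
  by rewrite -(privateE pb) -?eqf //; case/setD1P: aJ.
(* On an edge [ab], one end has a private neighbour as its value, and the other end is not adjacent
   to that value. *)
have f_inj : {in J &, injective f}.
  move=> a b aJ bJ eqf; have [//|nab] := eqVneq a b.
  have [/setD1P[_ aK] /setD1P[_ bK]] := (aJ, bJ).
  have [[w s]|[w s]] := clique_edge_crit aK bK nab.
    by have := clash _ _ _ aJ bJ nab s; rewrite eqf eqxx.
  by have := clash _ _ _ bJ aJ; rewrite eq_sym eqf eqxx => /(_ _ nab s).
have fJ : f @: J = W.
  apply/eqP; rewrite eqEcard card_in_imset //; apply/andP; split.
    by apply/subsetP=> _ /imsetP[b bJ ->]; case: (fP _ bJ).
  by move: ltWK; rewrite (cardsD1 v K) vK.
(* [f a] is a second common neighbour of [a] and [w = f b]. *)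
have indep a b w : a \in J -> b \in J -> sole_common_nbr a w b -> ~~ h (f a) (f b).
  move=> aJ bJ s; apply/negP=> hab.
  have [/setD1P[nav aK] /setD1P[nbv bK]] := (aJ, bJ).
  have pw : private b w.
    by apply: sole_private s; rewrite // 1?K_clique // eq_sym.
  have wW : w \in W by case/and3P: pw.
  have /imsetP[c cJ wc] : w \in f @: J by rewrite fJ.
  have [_ hcf _] := fP _ cJ.
  have cb : c = b.
    by apply/eqP; rewrite -(privateE pw) ?wc //; case/setD1P: cJ.
  have [_ u] := s; have [faW haf _] := fP _ aJ.
  have fab : f a = b by apply: u; rewrite ?wc ?cb // h_sym.
  by have := WK _ faW; rewrite fab bK.
(* By [indep] no edge joins two vertices of [W], whereas domination gives each vertex of [W] a
   neighbour in [W]. *)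
have : 0 < #|W|.
  rewrite -fJ card_in_imset // -ltnS.
  by move: K_gt2; rewrite (cardsD1 v K) vK => /ltnW.
case/card_gt0P=> w wW; have := wW; rewrite inE => /and3P[wV nwv _].
have [|p pW hwp] := @non_nbrs_dominate v w wV; first by rewrite eq_sym.
move: wW pW hwp; rewrite -/W -fJ => /imsetP[a aJ ->] /imsetP[b bJ ->] hab.
have [eab|nab] := eqVneq a b; first by rewrite eab h_irr in hab.
have [/setD1P[_ aK] /setD1P[_ bK]] := (aJ, bJ).
have [[z s]|[z s]] := clique_edge_crit aK bK nab.
  by have := indep _ _ _ aJ bJ s; rewrite hab.
by have := indep _ _ _ bJ aJ s; rewrite h_sym hab.
Qed.

Lemma clique_notin_bound : v \in V -> v \notin K -> #|K| <= #|non_nbrs v|.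
Proof.
move=> vV vK; rewrite leqNgt; apply/negP=> ltWK.
pose W := non_nbrs v :\: K; pose B := [set b in K | h v b].
have nonK k : k \in K -> (k \in non_nbrs v) = ~~ h v k.
  move=> kK; rewrite inE (subsetP K_V) //=.
  by case: eqVneq => [kv|//]; rewrite -kv kK in vK.
(* The non-neighbours of [v] inside [K] cancel from both sides of [ltWK]. *)
have ltWB : #|W| < #|B|.
  have BE : #|K| = #|K :&: non_nbrs v| + #|B|.
    rewrite -(cardsID (non_nbrs v) K); congr (_ + _); apply: eq_card => k.
    rewrite !inE; case: (boolP (k \in K)) => kK; rewrite ?andbF //=.
    by have := nonK k kK; rewrite inE => ->; rewrite negbK andbT.
  by move: ltWK; rewrite -(cardsID K (non_nbrs v)) BE setIC ltn_add2l.
have memW w : w \in V -> w != v -> ~~ h v w -> w \notin K -> w \in W.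
  by move=> wV nwv nvw wK; rewrite !inE wK wV nwv.
have nvK k : k \in K -> v != k by move=> kK; apply: contraNneq vK => ->.
pose g b := odflt b [pick w | private b w].
have gP b : [exists w, private b w] -> private b (g b).
  by case/existsP=> w bw; rewrite /g; case: pickP => [//|/(_ w)]; rewrite bw.
have privW b w : private b w -> w \in W by case/and3P=> wN wK _; rewrite inE wK.
have g_inj (A : {set T}) : {subset A <= K} -> {in A, forall b, private b (g b)} ->
    {in A &, injective g}.
  move=> AK AP b c bA cA eqg; apply/eqP.
  by rewrite -(privateE (AP _ cA)) ?AK // -eqg (privateE (AP _ bA)) ?AK.
(* Otherwise [g] would inject [B] into the smaller set [W]. *)
have [a aB no_private] : exists2 a, a \in B & forall w, ~~ private a w.
  have [/exists_inP[a aB /existsPn]|] := boolP [exists a in B, ~~ [exists w, private a w]].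
    by exists a.
  rewrite negb_exists_in => /forall_inP allP; move: ltWB; rewrite ltnNge.
  have gP' b : b \in B -> private b (g b) by move=> /allP/negPn/gP.
  rewrite -(card_in_imset (g_inj _ _ gP')) ?subset_leq_card //; last first.
    by move=> b; rewrite inE => /andP[].
  by apply/subsetP=> _ /imsetP[b /gP'/privW ? ->].
have [aK hva] : a \in K /\ h v a by apply/andP; rewrite inE in aB.
have arcs b : b \in B -> b != a -> exists2 w, sole_common_nbr a w b & private b w.
  rewrite inE => /andP[bK hvb]; rewrite eq_sym => nab.
  have [[w s]|[w s]] := clique_edge_crit aK bK nab.
    by exists w => //; apply: sole_private s => //; exact: nvK.
  by have /negP[] := no_private w; apply: sole_private s => //; exact: nvK.
(* By cardinality the injection [g] maps [B :\ a] onto [W], so the vertices found in [arcs] exhaust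
   [W]. In particular [a] has no neighbour in [W]. *)
have W_arc w : w \in W -> exists2 b, b \in K & sole_common_nbr a w b.
  have gP' b : b \in B :\ a -> private b (g b).
    by case/setD1P=> nba bB; have [w' _ ?] := arcs _ bB nba; apply/gP/existsP; exists w'.
  have BK : {subset B :\ a <= K} by move=> b; rewrite !inE => /and3P[].
  have gB : g @: (B :\ a) = W.
    apply/eqP; rewrite eqEcard (card_in_imset (g_inj _ BK gP')); apply/andP; split.
      by apply/subsetP=> _ /imsetP[b /gP'/privW ? ->].
    by move: ltWB; rewrite (cardsD1 a B) aB.
  rewrite -gB => /imsetP[b bB' ->]; exists b; first exact: BK.
  have /setD1P[nba bB] := bB'; have [w' s pw'] := arcs _ bB nba.
  have := privW _ _ pw'; rewrite -gB => /imsetP[c cB' w'c].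
  have cb : c = b.
    by apply/eqP; rewrite -(privateE pw') ?BK // w'c (privateE (gP' _ cB')) ?BK.
  by rewrite -cb -w'c cb.
have in_clique p q : sole_common_nbr p q a -> p \in non_nbrs v -> p \in K.
  case=> [[_ _ hap _] _] pN; apply: contraT => pK.
  have [|b bK [[_]]] := W_arc p; first by rewrite inE pK.
  by rewrite hap.
have no_clique_end p q : sole_common_nbr p q a -> p \in K -> False.
  move=> s pK; have qK := sole_notin_clique pK s; have qa := sole_clique_nbr pK s.
  have [[npq hpq hap haq] u] := s.
  have qV : q \in V by apply: (h_V (y := a)); rewrite h_sym.
  (* For [q] other than [v], a neighbour [x] of [q] among the non-neighbours of [v] lies in [W];
     then [q] is a common neighbour of [a] and [x], which forces it into [K]. *)
  have [qv|nqv] := eqVneq q v; last first.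
    have [|x xN hqx] := @non_nbrs_dominate v q qV; first by rewrite eq_sym.
    have [xK|xK] := boolP (x \in K).
      have xa : x = a by apply: qa; rewrite // h_sym.
      by have := nonK _ xK; rewrite xN xa hva.
    have [|b bK [_ u']] := W_arc x; first by rewrite inE xK.
    by move: qK; rewrite (u' q) ?bK // h_sym.
  (* Now [q] is [v], whose only neighbour in [K] is [a], so [B] has at most one element. *)
  have W0 x : x \notin W.
    suff : #|W| == 0 by rewrite cards_eq0 => /eqP ->; rewrite inE.
    rewrite -leqn0 -ltnS (leq_trans ltWB) // -(cards1 a) subset_leq_card //.
    apply/subsetP=> k /setIdP[kK hvk].
    by apply/set1P/qa; rewrite // qv h_sym.
  (* As [W] is empty, [y] outside [K] is adjacent to [v], that is to [q], and also to [p]. Hence [y]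
     is [a], which lies in [K]. *)
  have no_crit_p x y : sole_common_nbr x y p -> x \in non_nbrs v -> False.
    move=> sxy xN; have xK : x \in K.
      by apply: contraNT (W0 x) => xK; rewrite inE xK.
    have yK := sole_notin_clique xK sxy; have [[_ _ _ hpy] _] := sxy.
    have yV : y \in V by apply: (h_V (y := p)); rewrite h_sym.
    have nyv : y != v by apply: contraNneq hpq => yv; rewrite qv -yv.
    have hvy : h v y by apply: contraNT (W0 y) => nvy; exact: memW.
    have ya : y = a by apply: u; rewrite h_sym // qv.
    by rewrite ya aK in yK.
  have [x [y sxy]] := vertex_crit (subsetP K_V _ pK).
  have [xN|yN] := sole_non_nbr sxy (nvK _ pK); first exact: no_crit_p sxy xN.
  exact: no_crit_p (sole_common_nbrC sxy) yN.
have [p [q s]] := vertex_crit (subsetP K_V _ aK).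
have [pN|qN] := sole_non_nbr s (nvK _ aK).
  exact: no_clique_end s (in_clique _ _ s pN).
have s' := sole_common_nbrC s.
exact: no_clique_end s' (in_clique _ _ s' qN).
Qed.

End Clique.

Lemma clique_bound (K : {set T}) (v : T) :
  1 < #|V| -> K \subset V -> {in K &, forall x y, x != y -> h x y} ->
  v \in V -> #|K| <= #|non_nbrs v|.
Proof.
move=> V_gt1 K_V K_clique vV; have [K_le2|K_gt2] := leqP #|K| 2.
  exact: leq_trans K_le2 (non_nbrs_gt1 v V_gt1).
have [vK|vK] := boolP (v \in K); first exact: clique_mem_bound.
exact: clique_notin_bound.
Qed.

End Complement.

(** * Connected dominating sets of at most two vertices, seen in the complement *)

Definition co_rel (T : finType) (e : rel T) (V : {set T}) : rel T :=
  fun x y => [&& x \in V, y \in V, x != y & ~~ e x y].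

Lemma bigminn_le (I : eqType) (r : seq I) (P : pred I) (F : I -> nat) n i :
  i \in r -> P i -> \big[minn/n]_(j <- r | P j) F j <= F i.
Proof.
move=> + Pi; elim: r => [//|j r IHr]; rewrite inE big_cons => /orP[/eqP<-|/IHr le_r].
  by rewrite Pi geq_minl.
by case: ifP => // _; rewrite geq_min le_r orbT.
Qed.

(** The bound on [k] keeps the default value of the minimum from being the witness. *)
Lemma gamma_c_lt (T : finType) (e : rel T) (V : {set T}) k :
  k <= #|T|.+1 -> gamma_c e V < k -> exists2 D : {set T}, cds e V D & #|D| < k.
Proof.
move=> kT; rewrite /gamma_c.
elim/big_ind: _ => [|x y IHx IHy|D cD ltD]; first by rewrite ltnNge kT.
  by rewrite gtn_min => /orP[/IHx|/IHy].
by exists D.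
Qed.

Section DominatingPair.

Variables (T : finType) (e : rel T) (V : {set T}).
Hypothesis e_simple : simple_graph e.

Lemma co_rel_sym : symmetric (co_rel e V).
Proof.
by move=> x y; rewrite /co_rel e_simple.1 eq_sym andbCA.
Qed.

Lemma co_rel_irr : irreflexive (co_rel e V).
Proof. by move=> x; rewrite /co_rel eqxx !andbF. Qed.

Lemma connected_nbr c : connected_in e V -> 1 < #|V| -> c \in V ->
  exists2 u, u \in V & e c u.
Proof.
move=> conn V_gt1 cV.
have [d] : exists d, d \in V :\ c.
  by apply/set0Pn; rewrite -card_gt0; move: V_gt1; rewrite (cardsD1 c) cV.
case/setD1P=> ndc dV; have /connectP[[|u s] /= ps dE] := conn c d cV dV.
  by rewrite dE eqxx in ndc.
by case/andP: ps => /and3P[_ uV ecu] _; exists u.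
Qed.

(** The case [p = q] is allowed and stands for a single dominating vertex. *)
Definition dominating_pair (p q : T) : Prop :=
  [/\ p \in V, q \in V, ~~ co_rel e V p q
    & forall x, co_rel e V x p -> ~~ co_rel e V x q].

Lemma dominating_pair_gamma_c p q : dominating_pair p q -> gamma_c e V < 3.
Proof.
have [e_sym e_irr] := e_simple.
case=> pV qV npq dom; apply: (@leq_trans #|[set p; q]|.+1); last first.
  by rewrite ltnS cards2; case: (p != q).
apply: bigminn_le; rewrite ?mem_index_enum //; apply/and3P; split.
- by apply/subsetP=> x /set2P[] ->.
- apply/forall_inP=> x xV; apply: contraT; rewrite !inE !negb_or -andbA.
  case/and3P=> nxp nxq /exists_inPn nadj.
  have := dom x; rewrite /co_rel xV pV qV nxp nxq !nadj ?inE ?eqxx ?orbT //=.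
  by move/(_ isT).
have [<-|npq'] := eqVneq p q.
  by apply/forall_inP=> x /set2P[] ->; apply/forall_inP=> y /set2P[] ->.
have epq : e p q by move: npq; rewrite /co_rel pV qV npq' negbK.
apply/forall_inP=> x /set2P[] ->; apply/forall_inP=> y /set2P[] -> //;
  by apply: connect1; rewrite !inE !eqxx ?orbT //= e_sym.
Qed.

Lemma gamma_c_dominating_pair : 1 < #|T| -> V != set0 -> gamma_c e V < 3 ->
  exists p q, dominating_pair p q.
Proof.
have [e_sym e_irr] := e_simple.
move=> T_gt1 /set0Pn[v vV] /gamma_c_lt[//|D /and3P[DV /forall_inP dom conn] D_lt3].
have [p [q [pD qD DE]]] : exists p q, [/\ p \in D, q \in D & D = [set p; q]].
  have [y yD] : exists y, y \in D.
    by have /orP[?|/exists_inP[y]] := dom v vV; [exists v | exists y].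
  have : #|D :\ y| <= 1 by move: D_lt3; rewrite (cardsD1 y) yD.
  rewrite leq_eqVlt ltnS leqn0 cards_eq0 => /orP[/cards1P[z zE]|/eqP D0].
    have /setD1P[_ zD] : z \in D :\ y by rewrite zE set11.
    by exists y, z; split=> //; rewrite -zE setD1K.
  by exists y, y; split=> //; rewrite setUid -[RHS]setU0 -D0 setD1K.
exists p, q; split; rewrite ?(subsetP DV) //.
  rewrite /co_rel !(subsetP DV) //=; apply/andP=> -[npq /negP]; apply.
  (* The first edge of a path from [p] inside the pair can only lead to [q]. *)
  have /connectP[[|u s] /= ps qE] := forall_inP (forall_inP conn p pD) q qD.
    by rewrite qE eqxx in npq.
  move: ps; rewrite DE => /andP[/and3P[_ /set2P[] -> //]].
  by rewrite e_irr.
move=> x /and4P[xV _ nxp nexp]; rewrite /co_rel xV (subsetP DV) //=.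
have := dom x xV; rewrite DE !inE (negPf nxp) /=.
case/orP=> [/eqP->|/exists_inP[y /set2P[] ->] exy]; first by rewrite eqxx.
  by rewrite exy in nexp.
by rewrite exy andbF.
Qed.

End DominatingPair.

Lemma add_edge_simple (T : finType) (e : rel T) a b :
  simple_graph e -> a != b -> simple_graph (add_edge e a b).
Proof.
case=> e_sym e_irr nab; split=> [x y|x]; rewrite /add_edge.
  by rewrite e_sym orbC [in RHS]orbC; congr (_ || _); rewrite orbC andbC [X in _ || X]andbC.
by rewrite e_irr; have [->|_] := eqVneq x a; rewrite ?(negPf nab) ?andbF.
Qed.

Lemma co_rel_add_edge (T : finType) (e : rel T) V a b x y :
  co_rel (add_edge e a b) V x y =
    co_rel e V x y && ~~ ((x == a) && (y == b) || (x == b) && (y == a)).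
Proof. by rewrite /co_rel /add_edge negb_or !andbA. Qed.

(** * Criticality translated into the two complement conditions *)

Section Maximal.

Variables (T : finType) (e : rel T) (V : {set T}).
Hypothesis e_simple : simple_graph e.
Hypothesis e_max : maximal_vertex_critical e V 3.

Let h := co_rel e V.

Lemma maximal_V_gt2 : 2 < #|V|.
Proof. by have [_ [[]]] := e_max. Qed.

Lemma maximal_T_gt1 : 1 < #|T|.
Proof. exact: leq_trans (ltnW maximal_V_gt2) (max_card _). Qed.

(** Otherwise [p] and [q] form a dominating pair, against [gamma_c e V = 3]. *)
Lemma co_common_nbr p q : p \in V -> q \in V -> ~~ h p q ->
  exists x, h x p && h x q.
Proof.
move=> pV qV npq; apply/existsP; apply: contraT => /existsPn none.
have : gamma_c e V < 3.
  apply: (dominating_pair_gamma_c e_simple (p := p) (q := q)); split=> // x hxp.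
  by have := none x; rewrite -/h in hxp *; rewrite hxp.
by have [[-> _] _] := e_max.
Qed.

Lemma maximal_vertex_crit c : c \in V -> exists p q, sole_common_nbr h p q c.
Proof.
move=> cV; have [_ [[V_gt2 [[_ conn] del_conn]] [_ crit]]] := e_max.
have [p [q [/setD1P[npc pV] /setD1P[nqc qV] npq dom]]] :=
  gamma_c_dominating_pair e_simple maximal_T_gt1 (del_conn c cV).1 (crit c cV).
have hD x y : x != c -> y != c -> co_rel e (V :\ c) x y = h x y.
  by move=> nxc nyc; rewrite /h /co_rel !inE nxc nyc.
rewrite hD // in npq.
have uniq x : h x p -> h x q -> x = c.
  move=> hxp hxq; apply/eqP; apply: contraT => nxc.
  by have := dom x; rewrite !hD // hxp hxq => /(_ isT).
have [x /andP[hxp hxq]] := co_common_nbr pV qV npq.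
have xc := uniq _ hxp hxq; rewrite {x}xc in hxp hxq.
exists p, q; split=> //; split=> //; apply/negP=> /eqP eqpq.
(* If [p = q], then [c] is the only [h]-neighbour of [p]. A graph neighbour [u] of [c] then shares
   no [h]-neighbour with [p], against [co_common_nbr]. *)
rewrite -{q qV nqc npq dom hxq}eqpq in uniq.
have [u uV ecu] := connected_nbr conn (ltnW V_gt2) cV.
have npu : ~~ h p u.
  apply/negP; rewrite /h co_rel_sym // => hup; have uc := uniq _ hup hup.
  by move: ecu; rewrite uc e_simple.2.
have [x /andP[hxp' hxu]] := co_common_nbr pV uV npu.
by move: hxu; rewrite (uniq x) // /h /co_rel ecu !andbF.
Qed.

Lemma maximal_edge_crit a b c : h a b -> h c a -> h c b ->
  (exists w, sole_common_nbr h a w b) \/ (exists w, sole_common_nbr h b w a).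
Proof.
move=> hab hca hcb; have [[_ crit] _] := e_max.
have /and4P[aV bV nab neab] := hab.
have V0 : V != set0 by apply/set0Pn; exists a.
have [p [q [pV qV npq dom]]] := gamma_c_dominating_pair
  (add_edge_simple e_simple nab) maximal_T_gt1 V0 (crit a b aV bV nab neab).
have h_irr := co_rel_irr e V; have h_sym := co_rel_sym V e_simple.
have nca : c != a by apply: contraTneq hca => ->; rewrite /h h_irr.
have ncb : c != b by apply: contraTneq hcb => ->; rewrite /h h_irr.
have common y : h y p -> h y q -> y = a \/ y = b.
  move=> hyp hyq; have [->|nya] := eqVneq y a; [by left | right].
  apply/eqP; apply: contraT => nyb; have := dom y.
  by rewrite !co_rel_add_edge -/h hyp hyq (negPf nya) (negPf nyb) => /(_ isT).
(* The vertex [c] serves to exclude [w = a']: it would then be a common neighbour other than [a']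
   and [b']. *)
have sole a' b' w : h a' b' -> h c a' -> h b' w -> ~~ h a' w ->
    (forall y, h y a' -> h y w -> y = a' \/ y = b') -> c != b' ->
    sole_common_nbr h a' w b'.
  move=> hab' hca' hbw haw com ncb'; split.
    split=> //; last by rewrite /h h_sym.
    apply: contraNneq ncb' => eqw; rewrite -eqw in com.
    by have [ca|->//] := com c hca' hca'; move: hca'; rewrite ca /h h_irr.
  move=> y hya hyw; have [ya|//] := com y hya hyw.
  by move: hya; rewrite ya /h h_irr.
have npq_h : ~~ h p q.
  apply/negP=> hpq; move: npq; rewrite co_rel_add_edge -/h hpq negbK.
  by case/orP=> /andP[/eqP pE /eqP qE]; have := common c;
    rewrite pE qE => /(_ _ _)[] // cE; move: nca ncb; rewrite cE eqxx.
have [x /andP[hxp hxq]] := co_common_nbr pV qV npq_h.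
have hba : h b a by rewrite /h h_sym.
have nqp_h : ~~ h q p by rewrite /h h_sym.
have common' y : h y q -> h y p -> y = a \/ y = b by move=> ? ?; exact: common.
(* Since [x] no longer violates domination once [ab] is added, the lost [h]-edge joins [x] to [p] or
   to [q]; the remaining vertex of the pair is the required [w]. *)
have := dom x; rewrite !co_rel_add_edge -/h hxp hxq /= => /implyP.
rewrite negbK implybE negbK.
have swap y : y = a \/ y = b -> y = b \/ y = a by case; [right | left].
case/orP=> /orP[]/andP[/eqP xE /eqP pE]; rewrite xE pE in hxp hxq npq_h nqp_h common common' *.
- by right; exists q; apply: sole => // y hya hyw; apply/swap/common.
- by left; exists q; apply: sole => // y hya hyw; apply/common.
- by right; exists p; apply: sole => // y hya hyw; apply/swap/common'.
- by left; exists p; apply: sole => // y hya hyw; apply/common'.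
Qed.

End Maximal.

Theorem theorem3p3 (T : finType) (e : rel T) (V : {set T}) :
  simple_graph e -> graph_connected e V ->
  maximal_vertex_critical e V 3 ->
  alpha e V <= min_degree e V.
Proof.
move=> e_simple _ e_max; apply/bigmax_leqP=> K /andP[KV /forall_inP indep].
(* The default [#|T|] of the minimum bounds any [K] trivially. *)
rewrite /min_degree; elim/big_ind: _ => [|x y Kx Ky|v vV]; first exact: max_card.
  by rewrite leq_min Kx.
have -> : degree e V v = #|non_nbrs V (co_rel e V) v|.
  apply: eq_card => u; rewrite !inE /co_rel vV; case: (boolP (u \in V)) => //= uV.
  rewrite negb_and !negbK eq_sym; have [->|//] := eqVneq.
  by rewrite e_simple.2.
apply: (clique_bound (h := co_rel e V)) => //.
- exact: co_rel_sym.
- exact: co_rel_irr.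
- by move=> x y /andP[].
- exact: maximal_vertex_crit.
- exact: maximal_edge_crit.
- exact: ltnW (maximal_V_gt2 e_max).
move=> x y xK yK nxy; rewrite /co_rel !(subsetP KV) // nxy.
exact: (forall_inP (indep x xK)).
Qed.
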